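(* Let ${\cal G}=(G,c_{\cal G})$ be a graph model such that, after encoding, $G=\mathbb{N}$ and $c_{\cal G}$ is a computable map. Then the $\lambda$-model $({\cal P}(G),\subseteq,{\cal A},\lambda)$ generated by ${\cal G}$ is weakly effective. If moreover the range of $c_{\cal G}$ is decidable, then it is effective.
   Context: A graph model is a pair ${\cal G}=(G,c_{\cal G})$ with $G$ an infinite set and $c_{\cal G}:G^*\times G\to G$ an injective total function, where $G^*$ is the set of finite subsets of $G$ (finite subsets of $\mathbb{N}$ are coded by natural numbers in a standard way). It generates the reflexive cpo $({\cal P}(G),\subseteq)$ with $\lambda(f)=\{c_{\cal G}(a,\alpha): a\in G^*,\alpha\in f(a)\}$ and ${\cal A}(X)(Y)=\{\alpha:\exists a\subseteq Y\text{ finite}, c_{\cal G}(a,\alpha)\in X\}$. When $G=\mathbb{N}$, ${\cal P}(\mathbb{N})$ is an effective domain with compact elements the finite sets (standard numeration). An effective domain is a Scott domain with a surjective numeration $d$ of the compact elements making ''$d_m,d_n$ have an upper bound'' and ''$d_n=d_m\sqcup d_k$'' decidable; an element $v$ is r.e./decidable if $\{n:d_n\sqsubseteq v\}$ is r.e./decidable; function spaces are effective domains. A weakly effective $\lambda$-model is $(D,{\cal A},\lambda)$ with $D$ effective, ${\cal A}\in[D\to[D\to D]]$, $\lambda\in[[D\to D]\to D]$ r.e. elements with ${\cal A}\circ\lambda=id$. It is effective if moreover (i) for compact $d$ and decidable $e_1,\dots,e_n$, ${\cal A}(\dots{\cal A}({\cal A}(d)(e_1))\dots)(e_n)$ is decidable;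 (ii) if $f\in[D\to D]$ is r.e. and $f(e)$ is decidable for all compact $e$ then $\lambda(f)$ is decidable.
   Formalization: In clause (ii) of ''effective'', ''f(e) is decidable for all compact e'' is taken uniformly in a code of e; read separately for each e, the claim fails: for K r.e. undecidable, f(X)={0} if X meets K and ∅ otherwise, λ(f) is not decidable. *)

(* Defs.v *)
From HB Require Import structures.
From mathcomp Require Import all_boot all_order finmap.
From mathcomp Require Import boolp classical_sets functions cardinality.
Set Implicit Arguments.
Unset Strict Implicit.
Unset Printing Implicit Defensive.
Import Order.TTheory.
Local Open Scope classical_set_scope.
Local Open Scope order_scope.
Local Open Scope nat_scope.

(** * Computability on nat *)

(** The total recursive functions of [k] arguments: the least class containing
    zero, successor and projections and closed under composition, primitive
    recursion and minimization of regular functions (Kleene). *)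
Inductive recursive : forall k, (k.-tuple nat -> nat) -> Prop :=
| rec_zero : recursive (fun _ : 0.-tuple nat => 0)
| rec_succ : recursive (fun v : 1.-tuple nat => (thead v).+1)
| rec_proj k (i : 'I_k) : recursive (fun v : k.-tuple nat => tnth v i)
| rec_comp k m (f : m.-tuple nat -> nat) (g : 'I_m -> k.-tuple nat -> nat) :
    recursive f -> (forall i, recursive (g i)) ->
    recursive (fun v : k.-tuple nat => f [tuple g i v | i < m])
| rec_prim k (f : k.-tuple nat -> nat) (g : k.+2.-tuple nat -> nat)
    (h : k.+1.-tuple nat -> nat) :
    recursive f -> recursive g ->
    (forall v : k.-tuple nat, h [tuple of 0 :: v] = f v) ->
    (forall n (v : k.-tuple nat),
       h [tuple of n.+1 :: v] =
       g [tuple of n :: h [tuple of n :: v] :: v]) ->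
    recursive h
| rec_min k (g : k.+1.-tuple nat -> nat) (h : k.-tuple nat -> nat) :
    recursive g ->
    (forall v : k.-tuple nat, g [tuple of h v :: v] = 0 /\
       forall n, n < h v -> g [tuple of n :: v] <> 0) ->
    recursive h.

Definition decidable_rel k (P : k.-tuple nat -> Prop) : Prop :=
  exists2 f : k.-tuple nat -> nat, recursive f & forall v, P v <-> f v = 0.

Definition re_rel k (P : k.-tuple nat -> Prop) : Prop :=
  exists2 f : k.+1.-tuple nat -> nat, recursive f &
    forall v : k.-tuple nat, P v <-> exists n, f [tuple of n :: v] = 0.

Definition computable2 (f : nat -> nat -> nat) : Prop :=
  recursive (fun v : 2.-tuple nat => f (nth 0 v 0) (nth 0 v 1)).

Definition decidable1 (P : nat -> Prop) : Prop :=
  decidable_rel (fun v : 1.-tuple nat => P (nth 0 v 0)).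

Definition decidable2 (P : nat -> nat -> Prop) : Prop :=
  decidable_rel (fun v : 2.-tuple nat => P (nth 0 v 0) (nth 0 v 1)).

Definition decidable3 (P : nat -> nat -> nat -> Prop) : Prop :=
  decidable_rel
    (fun v : 3.-tuple nat => P (nth 0 v 0) (nth 0 v 1) (nth 0 v 2)).

Definition re1 (P : nat -> Prop) : Prop :=
  re_rel (fun v : 1.-tuple nat => P (nth 0 v 0)).

(** The standard (binary) code: [n] codes the finite set [{i1 < ... < ik}] when
    [n = 2 ^ i1 + ... + 2 ^ ik]. The bound [i < n] loses nothing. *)
Definition fincode (n : nat) : {fset nat} :=
  [fset i in iota 0 n | odd (n %/ 2 ^ i)]%fset.

(** Cantor pairing. *)
Definition cpair (i j : nat) : nat := ((i + j) * (i + j).+1)./2 + j.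

(** * Domains *)

Section Domains.
Context d (D : porderType d).
Implicit Types (A : set D) (x y : D).

Definition directed A : Prop :=
  A !=set0 /\
  forall x y, A x -> A y -> exists2 z, A z & (x <= z)%O /\ (y <= z)%O.

Definition compact_elt x : Prop :=
  forall A s, directed A -> isLub A s -> (x <= s)%O ->
  exists2 a, A a & (x <= a)%O.

Definition cpo : Prop := forall A, directed A -> exists s, isLub A s.

Definition algebraic : Prop :=
  forall v, let K := [set x | compact_elt x /\ (x <= v)%O] in
  directed K /\ isLub K v.

Definition bounded_complete : Prop :=
  forall A, has_ubound A -> exists s, isLub A s.

End Domains.

Arguments cpo {d} D.
Arguments algebraic {d} D.
Arguments bounded_complete {d} D.

(** The bottom element is part of [bPOrderType]. Countability of the set of
    compact elements is imposed by the numeration in [effective_domain]. *)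
Definition scott_domain d (D : bPOrderType d) : Prop :=
  [/\ cpo D, algebraic D & bounded_complete D].

Record effective_domain d (D : bPOrderType d) (num : nat -> D) : Prop :=
  EffectiveDomain {
    eff_scott : scott_domain D;
    eff_range : range num = [set x | compact_elt x];
    eff_bounded : decidable2 (fun m n => has_ubound [set num m; num n]);
    eff_join :
      decidable3 (fun n m k => isLub [set num m; num k] (num n)) }.

Definition re_elt d (D : porderType d) (num : nat -> D) (v : D) : Prop :=
  re1 (fun n => (num n <= v)%O).

Definition decidable_elt d (D : porderType d) (num : nat -> D) (v : D) : Prop :=
  decidable1 (fun n => (num n <= v)%O).

(** * Function spaces *)

Definition scott_continuous d (D : porderType d) d' (E : porderType d')
    (f : D -> E) : Prop :=
  forall A s, directed A -> isLub A s -> isLub (f @` A) (f s).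

Record contfun d (D : porderType d) d' (E : porderType d') := ContFun {
  contfun_val :> D -> E;
  contfunP : scott_continuous contfun_val }.

Notation "[ 'cont' D -> E ]" := (contfun D E)
  (at level 0, D at level 98, E at level 99,
   format "[ 'cont'  D  ->  E ]") : type_scope.

Section FunctionSpaceOrder.
Context d (D : porderType d) d' (E : porderType d').
Implicit Types f g h : contfun D E.

Lemma contfun_ext f g : (forall x, f x = g x) -> f = g.
Proof.
case: f g => [f fc] [g gc] /= fg.
have E1 : f = g by apply/funext.
by case: _ / E1 gc => gc; congr ContFun; exact: Prop_irrelevance.
Qed.

HB.instance Definition _ := gen_eqMixin (contfun D E).
HB.instance Definition _ := gen_choiceMixin (contfun D E).

Definition contfun_le f g : bool := `[< forall x, (f x <= g x)%O >].

Lemma contfun_le_refl : reflexive contfun_le.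
Proof. by move=> f; apply/asboolP => x. Qed.

Lemma contfun_le_anti : antisymmetric contfun_le.
Proof.
move=> f g /andP[/asboolP fg /asboolP gf]; apply: contfun_ext => x.
by apply: le_anti; rewrite fg gf.
Qed.

Lemma contfun_le_trans : transitive contfun_le.
Proof.
move=> g f h /asboolP fg /asboolP gh; apply/asboolP => x.
exact: le_trans (fg x) (gh x).
Qed.

HB.instance Definition _ := Order.Le_isPOrder.Build d' (contfun D E)
  contfun_le_refl contfun_le_anti contfun_le_trans.

Lemma contfun_leP f g : reflect (forall x, (f x <= g x)%O) (f <= g)%O.
Proof. exact: asboolP. Qed.

End FunctionSpaceOrder.

Section FunctionSpaceBottom.
Context d (D : porderType d) d' (E : bPOrderType d').

Lemma bot_scott_continuous : scott_continuous (fun _ : D => \bot%O : E).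
Proof.
move=> A s [[a Aa] _] _; split=> [_ [x _ <-] //|b _]; exact: le0x.
Qed.

Definition contfun_bot : contfun D E := ContFun bot_scott_continuous.

Lemma contfun_le0 (f : contfun D E) : (contfun_bot <= f)%O.
Proof. by apply/contfun_leP => x; exact: le0x. Qed.

HB.instance Definition _ :=
  Order.hasBottom.Build d' (contfun D E) contfun_le0.

End FunctionSpaceBottom.

(** [f] is the step function sending [x] to [b] if [a] is below [x], and to
    bottom otherwise. *)
Definition is_step d (D : bPOrderType d) d' (E : bPOrderType d')
    (a : D) (b : E) (f : contfun D E) : Prop :=
  forall x, f x = (if (a <= x)%O then b else \bot%O).

(** Standard numeration of the compact elements of a function space: [n] codes
    a finite set of (coded) pairs [(i, j)], hence a finite set of step functions
    from [numD i] to [numE j], and [num_fun n] is their least upper bound. The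
    operator [supremum] returns its default, here bottom, on the codes of
    families of step functions without a least upper bound. *)
Definition num_fun d (D : bPOrderType d) (numD : nat -> D)
    d' (E : bPOrderType d') (numE : nat -> E) (n : nat) : contfun D E :=
  supremum \bot%O [set f | exists i j,
    cpair i j \in fincode n /\ is_step (numD i) (numE j) f].

(** * Effective lambda-models *)

Record weakly_effective_model d (D : bPOrderType d) (num : nat -> D)
    (app : [cont D -> [cont D -> D]]) (lam : [cont [cont D -> D] -> D]) : Prop :=
  WeaklyEffectiveModel {
    wem_domain : effective_domain num;
    wem_app : re_elt (num_fun num (num_fun num num)) app;
    wem_lam : re_elt (num_fun (num_fun num num) num) lam;
    wem_appK : forall f, app (lam f) = f }.

(** In [em_lam], "[f e] is decidable for every compact [e]" is read uniformly
    in (a code of) [e]. With a separate decision procedure for each [e] the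
    clause would fail in every graph model with a computable injection: if [K]
    is r.e. and undecidable then [f], mapping [X] to [{0}] if [X] meets [K]
    and to the empty set otherwise, is r.e. and all its values are finite,
    but a decision procedure for [lam f] would decide [K], as
    [c ({n}, 0) \in lam f] iff [n \in K]. *)
Record effective_model d (D : bPOrderType d) (num : nat -> D)
    (app : [cont D -> [cont D -> D]]) (lam : [cont [cont D -> D] -> D]) : Prop :=
  EffectiveModel {
    em_weak : weakly_effective_model num app lam;
    em_app : forall (x : D) (es : seq D), compact_elt x ->
      (forall e, e \in es -> decidable_elt num e) ->
      decidable_elt num (foldl (fun y e => app y e) x es);
    em_lam : forall f : [cont D -> D],
      re_elt (num_fun num num) f ->
      decidable2 (fun m n => (num m <= f (num n))%O) ->
      decidable_elt num (lam f) }.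

(** * Graph models *)

Record graph_model (G : choiceType) := GraphModel {
  gm_code :> {fset G} * G -> G;
  gm_infinite : infinite_set [set: G];
  gm_inj : injective gm_code }.

Section GraphModel.
Context (G : choiceType) (M : graph_model G).
Implicit Types X Y : set G.

Lemma isLub_set (A : set (set G)) X :
  isLub A X -> forall x, X x <-> exists2 Y, A Y & Y x.
Proof.
move=> [ub lub] x; split=> [Xx|[Y /ub]]; last first.
  by move=> /asboolP; apply.
have /asboolP/(_ x Xx) [Y AY Yx] : (X <= \bigcup_(Y in A) Y)%O.
  by apply: lub => Y AY; apply/asboolP => y Yy; exists Y.
by exists Y.
Qed.

Definition graph_app_fun X Y : set G :=
  [set al | exists2 a : {fset G}, [set` a] `<=` Y & X (M (a, al))].

Definition graph_lam_fun (f : set G -> set G) : set G :=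
  [set x | exists (a : {fset G}) al, f [set` a] al /\ x = M (a, al)].

Lemma directed_fsub (A : set (set G)) X (a : {fset G}) :
  directed A -> isLub A X -> [set` a] `<=` X -> exists2 Y, A Y & [set` a] `<=` Y.
Proof.
move=> [[Y0 AY0] dA] lX; elim/finSet_rect: a => a IH aX.
have [->|[x xa]] := fset_0Vmem a; first by exists Y0 => // y; rewrite /= inE.
have xX : X x by apply: aX.
have [Y1 AY1 Y1x] := (isLub_set lX x).1 xX.
have [|y|Y2 AY2 Y2a] := IH (a `\ x)%fset; first exact: fproperD1.
  by move=> /= /fsetD1P[_ ya]; exact: aX.
have [Z AZ [/asboolP Y1Z /asboolP Y2Z]] := dA _ _ AY1 AY2.
exists Z => // y /= ya; have [->|yx] := eqVneq y x; first exact: Y1Z.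
by apply: Y2Z; apply: Y2a; rewrite /= !inE yx.
Qed.

Lemma graph_app_fun_continuous X : scott_continuous (graph_app_fun X).
Proof.
move=> A s dA ls; split=> [_ [Y AY <-]|Z ubZ]; apply/asboolP => al [a aY Xa].
  exists a => // x /aY Yx; apply/(isLub_set ls); by exists Y.
have [Y AY aY'] := directed_fsub dA ls aY.
have /asboolP : (graph_app_fun X Y <= Z)%O by apply: ubZ; exists Y.
by apply; exists a.
Qed.

Definition graph_app1 X : [cont set G -> set G] :=
  ContFun (@graph_app_fun_continuous X).

Lemma graph_app1_continuous : scott_continuous graph_app1.
Proof.
move=> A s dA ls; split=> [_ [Y AY <-]|g ubg].
  apply/contfun_leP => Z; apply/asboolP => al [a aZ Ya].
  by exists a => //; apply/(isLub_set ls); exists Y.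
apply/contfun_leP => Z; apply/asboolP => al [a aZ /(isLub_set ls)[Y AY Ya]].
have /contfun_leP/(_ Z)/asboolP : (graph_app1 Y <= g)%O by apply: ubg; exists Y.
by apply; exists a.
Qed.

Definition graph_app : [cont set G -> [cont set G -> set G]] :=
  ContFun graph_app1_continuous.

Lemma contfun_mono (f : [cont set G -> set G]) X Y : X `<=` Y -> f X `<=` f Y.
Proof.
move=> XY.
have dA : directed [set X; Y].
  split; first by exists X; left.
  by move=> _ _ [->|->] [->|->]; exists Y => //=; do ?[by right];
    split; apply/asboolP.
have lA : isLub [set X; Y] Y.
  split=> [_ [->|->]|Z ubZ]; do ?exact/asboolP.
  by apply: ubZ; right.
have [ub _] := contfunP f dA lA.
by have /asboolP : (f X <= f Y)%O by apply: ub; exists X => //; left.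
Qed.

Lemma union_continuous (B : set [cont set G -> set G]) :
  scott_continuous (fun X => [set x | exists2 f, B f & f X x]).
Proof.
move=> A s dA ls; split=> [_ [Y AY <-]|Z ubZ]; apply/asboolP => x [f Bf fx].
  exists f => //; apply: contfun_mono fx => y Yy.
  by apply/(isLub_set ls); exists Y.
have [_ [Y AY <-] fYx] := (isLub_set (contfunP f dA ls) x).1 fx.
suff /asboolP : ([set x | exists2 f, B f & f Y x] <= Z)%O by apply; exists f.
by apply: ubZ; exists Y.
Qed.

Lemma graph_lam_fun_continuous :
  scott_continuous (fun f : [cont set G -> set G] => graph_lam_fun f).
Proof.
move=> B s dB [ubs lubs]; split=> [_ [f Bf <-]|Z ubZ]; apply/asboolP => x.
  move=> [a [al [fa ->]]]; exists a, al; split=> //.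
  by have /contfun_leP/(_ [set` a])/asboolP := ubs _ Bf; apply.
move=> [a [al [sa ->]]].
have /contfun_leP/(_ [set` a])/asboolP/(_ _ sa) :
    (s <= ContFun (@union_continuous B))%O.
  apply: lubs => f Bf; apply/contfun_leP => X; apply/asboolP => y fy.
  by exists f.
move=> [f Bf fa].
have /asboolP : (graph_lam_fun f <= Z)%O by apply: ubZ; exists f.
by apply; exists a, al.
Qed.

Definition graph_lam : [cont [cont set G -> set G] -> set G] :=
  ContFun graph_lam_fun_continuous.

End GraphModel.

(** Finite subsets of [G], and compact elements of [set G], coded through a
    decoding [dec : nat -> G] of the points of [G]. *)
Definition fin_num (G : choiceType) (dec : nat -> G) (n : nat) : {fset G} :=
  [fset dec i | i in fincode n]%fset.

Definition set_num (G : choiceType) (dec : nat -> G) (n : nat) : set G :=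
  [set` fin_num dec n].

(* Main.v *)
From Stdlib Require Import List.
Require Import Defs.
From mathcomp Require Import all_boot all_order finmap.
From mathcomp Require Import boolp classical_sets functions cardinality.
Set Implicit Arguments.
Unset Strict Implicit.
Unset Printing Implicit Defensive.
Import Order.TTheory.

Local Open Scope classical_set_scope.
Local Open Scope nat_scope.

(** In the function spaces, a compact element is a finite join of step functions
    [a => b], and it lies below [g] iff [b] lies below [g a] for each of these
    steps. So, on codes, "below [app]" and "below [lam]" become bounded universal
    quantifications of r.e. conditions on the computable map [c].

    If [X] is finite then so is [app X Y], because [c] is injective: this gives
    the first clause of effectiveness, whatever [Y] is. For the second one,
    [x \in lam f] is decided by checking first that [x] is in the range of [c];
    then the search for the unique [(a, al)] with [c (a, al) = x] terminates, and
    it remains to decide [al \in f a]. *)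

(** * Recursive functions and r.e. predicates in environments *)

(* Arities are hidden by letting functions read a list of arguments, where the
   missing arguments are [0]; a quantifier pushes its variable on the list. *)
Definition rfun (F : seq nat -> nat) : Prop :=
  forall k, recursive (fun v : k.-tuple nat => F v).

Definition rpred (p : seq nat -> bool) : Prop := rfun (fun s => p s : nat).

(* The environment comes last, so that [var i (behead s)] unifies with
   [?a (?b s)] in [rfun_app]. *)
Definition var i (s : seq nat) : nat := nth 0 s i.

Lemma recursive_ext k (f g : k.-tuple nat -> nat) :
  f =1 g -> recursive g -> recursive f.
Proof. by move=> /funext ->. Qed.

Lemma recursive_cst k c : recursive (fun _ : k.-tuple nat => c).
Proof.
elim: c => [|c IH].
  (* [rec_zero] is nullary; composing it with the empty family gives the zero of arity [k]. *)
  by apply: (rec_comp (g := fun (_ : 'I_0) (_ : k.-tuple nat) => 0) rec_zero);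
    case.
apply: recursive_ext (rec_comp (g := fun _ _ => c) rec_succ (fun=> IH)) => v.
by rewrite /thead tnth_mktuple.
Qed.

Lemma rfun_cst c : rfun (fun=> c).
Proof. by move=> k; exact: recursive_cst. Qed.

Lemma rfun_var i : rfun (var i).
Proof.
move=> k; have [ik|ki] := ltnP i k.
  apply: recursive_ext (rec_proj (Ordinal ik)) => v.
  by rewrite (tnth_nth 0).
apply: recursive_ext (recursive_cst k 0) => v.
by rewrite /var nth_default ?size_tuple.
Qed.

(** Composition: the terms of [l] become the leading arguments, followed by the environment without
    its first [d] entries. As [F] is recursive at every arity, it can be taken at arity
    [size l + (k - d)], the exact length of this list. *)
Lemma rfun_subst F (l : seq (seq nat -> nat)) d : rfun F -> Forall rfun l ->
  rfun (fun s => F ([seq a s | a <- l] ++ iter d behead s)).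
Proof.
move=> rF rl k.
pose g (i : 'I_(size l + (k - d))) (v : k.-tuple nat) :=
  if i < size l then nth (fun=> 0) l i v else var (d + (i - size l)) v.
have rg i : recursive (g i).
  rewrite /g; case: ltnP => il; last exact: rfun_var.
  elim: rl (i : nat) il => {g i} [//|a l' ra _ IH [_|i]] /=; first exact: ra.
  exact: IH.
apply: recursive_ext (rec_comp (rF _) rg) => v; congr (F _).
have nth_iter e (t : seq nat) i : nth 0 (iter e behead t) i = nth 0 t (e + i).
  by elim: e i => //= e IH i; rewrite nth_behead IH addnS.
have size_iter e (t : seq nat) : size (iter e behead t) = size t - e.
  by elim: e => [|e IH]; rewrite ?subn0 //= size_behead IH subnS.
apply: (@eq_from_nth _ 0); rewrite size_cat size_map size_iter !size_tuple //.
move=> i il; rewrite -(tnth_nth 0 _ (Ordinal il)) tnth_mktuple /g /=.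
rewrite nth_cat size_map; case: ltnP => ils; last by rewrite nth_iter.
by rewrite (nth_map (fun=> 0)).
Qed.

(** Through this class the proof search gets across any number of [behead]. *)
Definition rsubst (b : seq nat -> seq nat) : Prop :=
  forall F, rfun F -> rfun (fun s => F (b s)).

Lemma rsubst_id : rsubst id.
Proof. by []. Qed.

Lemma rsubst_behead b : rsubst b -> rsubst (fun s => behead (b s)).
Proof.
by move=> rb F rF; exact: (rb (F \o behead) (rfun_subst 1 rF (Forall_nil _))).
Qed.

Lemma rfun_app a b : rfun a -> rsubst b -> rfun (fun s => a (b s)).
Proof. by move=> ra; apply. Qed.

Lemma rfun_comp2 f a b : computable2 f -> rfun a -> rfun b ->
  rfun (fun s => f (a s) (b s)).
Proof.
move=> rf ra rb k; pose g (i : 'I_2) := if i == ord0 then a else b.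
have rg i : recursive (fun v : k.-tuple nat => g i v).
  by rewrite /g; case: eqP => _; [exact: ra|exact: rb].
apply: recursive_ext (rec_comp rf rg) => v.
by rewrite -(tnth_nth 0 _ ord0) -(tnth_nth 0 _ ord_max) !tnth_mktuple.
Qed.

(** Primitive recursion in environment form: the step reads the counter, then the accumulator, then
    the outer environment. *)
Lemma rfun_iteri f (g : nat -> nat -> seq nat -> nat) b : rfun f ->
  rfun (fun s => g (var 0 s) (var 1 s) (behead (behead s))) -> rfun b ->
  rfun (fun s => iteri (b s) (fun n r => g n r s) (f s)).
Proof.
move=> rf rg rb.
have ri : rfun (fun s => iteri (var 0 s) (fun n r => g n r (behead s)) (f (behead s))).
  move=> [|k]; last exact: (rec_prim (rf k) (rg k.+2)).
  (* At arity 0 the iteration count is the default 0, which leaves the initial value. *)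
  by apply: recursive_ext (recursive_cst 0 (f [::])) => v; rewrite (tuple0 v).
exact: (rfun_subst 0 ri (Forall_cons _ rb (Forall_nil _))).
Qed.

Lemma rpred_min (p : nat -> seq nat -> bool) h :
  rpred (fun s => p (var 0 s) (behead s)) ->
  (forall s, p (h s) s /\ forall n, n < h s -> ~~ p n s) -> rfun h.
Proof.
move=> rp hP k.
(* [rec_min] looks for a zero: a true test iterates once and gives 0, a false one keeps 1. *)
have rn : rfun (fun s => iteri (p (var 0 s) (behead s)) (fun _ _ => 0) 1).
  by apply: rfun_iteri => //; exact: rfun_cst.
apply: (rec_min (rn k.+1)) => v; have [ph minh] := hP v; split=> /= [|n nh].
  by rewrite /var /= ph.
by rewrite /var /= (negbTE (minh _ nh)).
Qed.

Lemma rpred_search (p : nat -> seq nat -> bool) :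
  rpred (fun s => p (var 0 s) (behead s)) -> (forall s, exists n, p n s) ->
  exists2 h, rfun h & forall s, p (h s) s.
Proof.
move=> rp ex_p; exists (fun s => ex_minn (ex_p s)) => [|s]; last by case: ex_minnP.
apply: (rpred_min rp) => s; case: ex_minnP => n pn min_n; split=> // m mn.
by apply: contraL mn => /min_n; rewrite -leqNgt.
Qed.

(* Closure under arithmetic and bounded quantification *)
Create HintDb rfun.
Ltac rfun := cbv beta; solve [auto 50 with nocore rfun].

#[local] Hint Resolve rfun_cst rfun_var : rfun.
#[local] Hint Resolve rsubst_id rsubst_behead : rfun.
#[local] Hint Resolve rfun_app | 20 : rfun.

Lemma rfun_succ a : rfun a -> rfun (fun s => (a s).+1).
Proof.
move=> ra k; apply: recursive_ext (rec_comp rec_succ (fun=> ra k)) => v.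
by rewrite /thead tnth_mktuple.
Qed.
#[local] Hint Resolve rfun_succ : rfun.

Lemma rfun_add a b : rfun a -> rfun b -> rfun (fun s => a s + b s).
Proof.
move=> ra rb; rewrite (_ : (fun _ => _) =
    fun s => iteri (b s) (fun _ r => r.+1) (a s)).
  by apply: rfun_iteri; rfun.
by apply/funext => s; elim: (b s) => [|n IH]; rewrite ?addn0 // addnS IH.
Qed.
#[local] Hint Resolve rfun_add : rfun.

Lemma rfun_mul a b : rfun a -> rfun b -> rfun (fun s => a s * b s).
Proof.
move=> ra rb; rewrite (_ : (fun _ => _) =
    fun s => iteri (b s) (fun _ r => a s + r) 0).
  by apply: (rfun_iteri (g := fun _ r s => a s + r)); rfun.
by apply/funext => s; elim: (b s) => [|n IH]; rewrite ?muln0 // mulnS IH.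
Qed.
#[local] Hint Resolve rfun_mul : rfun.

(** The last round of the recursion returns its own counter, one less than the number of rounds. *)
Lemma rfun_pred a : rfun a -> rfun (fun s => (a s).-1).
Proof.
move=> ra; rewrite (_ : (fun _ => _) = fun s => iteri (a s) (fun n _ => n) 0).
  by apply: rfun_iteri; rfun.
by apply/funext => s; case: (a s).
Qed.
#[local] Hint Resolve rfun_pred : rfun.

Lemma rfun_sub a b : rfun a -> rfun b -> rfun (fun s => a s - b s).
Proof.
move=> ra rb; rewrite (_ : (fun _ => _) =
    fun s => iteri (b s) (fun _ r => r.-1) (a s)).
  by apply: rfun_iteri; rfun.
by apply/funext => s; elim: (b s) => [|n IH]; rewrite ?subn0 // subnS IH.
Qed.
#[local] Hint Resolve rfun_sub : rfun.

Lemma rfun_exp2 a : rfun a -> rfun (fun s => 2 ^ a s).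
Proof.
move=> ra; rewrite (_ : (fun _ => _) = fun s => iteri (a s) (fun _ r => 2 * r) 1).
  by apply: rfun_iteri; rfun.
by apply/funext => s; elim: (a s) => [|n IH]; rewrite ?expnS ?IH.
Qed.
#[local] Hint Resolve rfun_exp2 : rfun.

Lemma rpred_bool (p : seq nat -> bool) : rpred p -> rfun (fun s => p s).
Proof. by []. Qed.
#[local] Hint Resolve rpred_bool : rfun.

Lemma rpred_app (p : seq nat -> bool) b :
  rpred p -> rsubst b -> rpred (fun s => p (b s)).
Proof. by move=> rp rb; exact: (rb _ rp). Qed.
#[local] Hint Resolve rpred_app | 20 : rfun.

Lemma rpred_neg (p : seq nat -> bool) : rpred p -> rpred (fun s => ~~ p s).
Proof.
move=> rp; rewrite /rpred (_ : (fun _ => _) = fun s => 1 - p s); first by rfun.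
by apply/funext => s; case: (p s).
Qed.
#[local] Hint Resolve rpred_neg : rfun.

Lemma rpred_and (p q : seq nat -> bool) :
  rpred p -> rpred q -> rpred (fun s => p s && q s).
Proof.
move=> rp rq; rewrite /rpred (_ : (fun _ => _) = fun s => p s * q s).
  by rfun.
by apply/funext => s; rewrite mulnb.
Qed.
#[local] Hint Resolve rpred_and : rfun.

Lemma rpred_or (p q : seq nat -> bool) :
  rpred p -> rpred q -> rpred (fun s => p s || q s).
Proof.
move=> rp rq; rewrite (_ : (fun _ => _) = fun s => ~~ (~~ p s && ~~ q s)).
  by rfun.
by apply/funext => s; rewrite negb_and !negbK.
Qed.
#[local] Hint Resolve rpred_or : rfun.

Lemma rpred_implb (p q : seq nat -> bool) :
  rpred p -> rpred q -> rpred (fun s => p s ==> q s).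
Proof.
move=> rp rq; rewrite (_ : (fun _ => _) = fun s => ~~ p s || q s); first by rfun.
by apply/funext => s; rewrite implybE.
Qed.
#[local] Hint Resolve rpred_implb : rfun.

Lemma rpred_eq0 a : rfun a -> rpred (fun s => a s == 0).
Proof.
move=> ra; rewrite /rpred (_ : (fun _ => _) = fun s => 1 - a s); first by rfun.
by apply/funext => s; case: (a s) => [|[]].
Qed.
#[local] Hint Resolve rpred_eq0 : rfun.

Lemma rpred_leq a b : rfun a -> rfun b -> rpred (fun s => a s <= b s).
Proof. by move=> ra rb; apply: rpred_eq0; rfun. Qed.
#[local] Hint Resolve rpred_leq : rfun.

Lemma rpred_eqn a b : rfun a -> rfun b -> rpred (fun s => a s == b s).
Proof.
move=> ra rb.
rewrite (_ : (fun _ => _) = fun s => (a s <= b s) && (b s <= a s)).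
  by rfun.
by apply/funext => s; rewrite eqn_leq.
Qed.
#[local] Hint Resolve rpred_eqn : rfun.

Lemma rpred_odd a : rfun a -> rpred (fun s => odd (a s)).
Proof.
move=> ra; rewrite /rpred (_ : (fun _ => _) =
    fun s => iteri (a s) (fun _ r => 1 - r) 0).
  by apply: rfun_iteri; rfun.
by apply/funext => s; elim: (a s) => //= n <-; case: odd.
Qed.
#[local] Hint Resolve rpred_odd : rfun.

Lemma rfun_half a : rfun a -> rfun (fun s => (a s)./2).
Proof.
move=> ra; rewrite (_ : (fun _ => _) =
    fun s => iteri (a s) (fun n r => odd n + r) 0).
  by apply: rfun_iteri; rfun.
by apply/funext => s; elim: (a s) => //= n <-; rewrite uphalf_half.
Qed.
#[local] Hint Resolve rfun_half : rfun.

(** A shift of binary digits, by repeated halving; it serves to read the codes of finite sets. *)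
Lemma rfun_div_exp2 a b : rfun a -> rfun b -> rfun (fun s => a s %/ 2 ^ b s).
Proof.
move=> ra rb; rewrite (_ : (fun _ => _) =
    fun s => iteri (b s) (fun _ r => r./2) (a s)).
  by apply: rfun_iteri; rfun.
apply/funext => s; elim: (b s) => [|n /= <-]; first by rewrite divn1.
by rewrite expnSr divnMA divn2.
Qed.
#[local] Hint Resolve rfun_div_exp2 : rfun.

Lemma rfun_cpair a b : rfun a -> rfun b -> rfun (fun s => cpair (a s) (b s)).
Proof. by rewrite /cpair => ra rb; rfun. Qed.
#[local] Hint Resolve rfun_cpair : rfun.

Lemma rpred_has (p : nat -> seq nat -> bool) b : rfun b ->
  rpred (fun s => p (var 0 s) (behead s)) ->
  rpred (fun s => has (p^~ s) (iota 0 (b s))).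
Proof.
move=> rb rp; rewrite /rpred (_ : (fun _ => _) =
    fun s => iteri (b s) (fun n r => p n s || (r != 0)) 0).
  apply: (rfun_iteri (g := fun n r s => p n s || (r != 0))); [rfun| |rfun].
  (* Inside the iteration the accumulator sits between the counter and the environment; the
     substitution removes it. *)
  have rp' : rpred (fun s => p (var 0 s) (behead (behead s))).
    exact: (rfun_subst 2 rp (Forall_cons _ (rfun_var 0) (Forall_nil _))).
  by rfun.
apply/funext => s; elim: (b s) => // n IH.
rewrite -addn1 iotaD has_cat has_seq1 orbC addn1 /= -IH.
by case: has.
Qed.

Lemma rpred_all (p : nat -> seq nat -> bool) b : rfun b ->
  rpred (fun s => p (var 0 s) (behead s)) ->
  rpred (fun s => all (p^~ s) (iota 0 (b s))).
Proof.
move=> rb rp; rewrite (_ : (fun _ => _) =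
    fun s => ~~ has (fun i => ~~ p i s) (iota 0 (b s))).
  by apply: rpred_neg; apply: (rpred_has (p := fun i s => ~~ p i s)); rfun.
by apply/funext => s; rewrite -all_predC; apply: eq_all => i /=; rewrite negbK.
Qed.
#[local] Hint Resolve rpred_has rpred_all : rfun.

(** * Decidable and recursively enumerable relations *)

Lemma decidable_rpred k (P : k.-tuple nat -> Prop) (p : seq nat -> bool) :
  rpred p -> (forall v, P v <-> p v) -> decidable_rel P.
Proof.
(* Truth is the value 0 in [decidable_rel] but 1 in [rpred]. *)
move=> rp Pp; have rn : rpred (fun s => ~~ p s) by rfun.
by exists (fun v => ~~ p v); [exact: rn|move=> v; rewrite Pp; case: (p v)].
Qed.

(** The given characteristic function has arity one; composing it with recursive terms makes it
    usable in any environment. *)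
Lemma decidable1_rpred (P : nat -> Prop) : decidable1 P ->
  exists2 p : nat -> bool, forall n, P n <-> p n &
    forall a, rfun a -> rpred (fun s => p (a s)).
Proof.
move=> [f rf Pf]; exists (fun n => f [tuple n] == 0) => [n|a ra].
  by rewrite (Pf [tuple n]); split=> /eqP.
have rfa : rfun (fun s => f [tuple a s]).
  move=> k; apply: recursive_ext (rec_comp rf (fun=> ra k)) => v.
  by congr f; apply: eq_from_tnth => i; rewrite tnth_mktuple (ord1 i).
by rfun.
Qed.

Lemma decidable2_rpred (P : nat -> nat -> Prop) : decidable2 P ->
  exists2 p : nat -> nat -> bool, forall m n, P m n <-> p m n &
    forall a b, rfun a -> rfun b -> rpred (fun s => p (a s) (b s)).
Proof.
move=> [f rf Pf]; exists (fun m n => f [tuple m; n] == 0) => [m n|a b ra rb].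
  by rewrite (Pf [tuple m; n]); split=> /eqP.
have rfa : rfun (fun s => f [tuple a s; b s]).
  apply: (rfun_comp2 (f := fun m n => f [tuple m; n])) => //.
  apply: recursive_ext rf => v.
  by congr (f _); apply: eq_from_tnth => -[[|[|]] // i2]; rewrite !(tnth_nth 0).
by rfun.
Qed.

(* Monotonicity in the search bound lets one bound serve finitely many
   searches. *)
Definition re_pred (P : seq nat -> Prop) : Prop :=
  exists p : nat -> seq nat -> bool,
    [/\ rpred (fun s => p (var 0 s) (behead s)),
        forall m n s, m <= n -> p m s -> p n s &
        forall s, P s <-> exists n, p n s].

Lemma re_pred_rel k (P : seq nat -> Prop) (Q : k.-tuple nat -> Prop) :
  re_pred P -> (forall v, Q v <-> P v) -> re_rel Q.
Proof.
move=> [p [rp _ Pp]] QP.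
have rn : rpred (fun s => ~~ p (var 0 s) (behead s)) by rfun.
exists (fun v => ~~ p (var 0 v) (behead v)); first exact: rn.
by move=> v; rewrite QP Pp; split=> -[n pn]; exists n; move: pn; rewrite /var /=;
  case: (p n v).
Qed.

Lemma re_rpred (p : seq nat -> bool) : rpred p -> re_pred p.
Proof.
move=> rp; exists (fun=> p); split=> // [|s]; first by rfun.
by split=> [ps|[]//]; exists 0.
Qed.

(** A decidable premise can be tested at each search bound; where it fails, every bound is
    accepted. *)
Lemma re_imply (b : seq nat -> bool) (P : seq nat -> Prop) :
  rpred b -> re_pred P -> re_pred (fun s => b s -> P s).
Proof.
move=> rb [p [rp mp Pp]]; exists (fun n s => b s ==> p n s).
split=> [|m n s mn /implyP bp|s]; first by rfun.
  by apply/implyP => /bp; exact: mp.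
rewrite Pp; case: (b s) => /=; first by split=> [/(_ isT)|//].
by split=> // _; exists 0.
Qed.

(** In [re_pred] the search bound stands on top of the quantified variable, while a bounded
    quantifier needs its variable on top. *)
Lemma rpred_swap (p : nat -> seq nat -> bool) :
  rpred (fun s => p (var 0 s) (behead s)) ->
  rpred (fun s => p (var 0 (behead s)) (var 0 s :: behead (behead s))).
Proof.
move=> rp; have rv : rfun (fun s => var 0 (behead s)) by rfun.
exact: (rfun_subst 2 rp
  (Forall_cons _ rv (Forall_cons _ (rfun_var 0) (Forall_nil _)))).
Qed.

Lemma re_ball (P : nat -> seq nat -> Prop) b : rfun b ->
  re_pred (fun s => P (var 0 s) (behead s)) ->
  re_pred (fun s => forall i, i < b s -> P i s).
Proof.
move=> rb [p [rp mp Pp]].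
exists (fun n s => all (fun i => p n (i :: s)) (iota 0 (b s))).
split=> [|m n s mn /allP pm|s].
- have rp' := rpred_swap rp.
  apply: (rpred_all (p := fun i s => p (var 0 s) (i :: behead s))); rfun.
- by apply/allP => i /pm; exact: mp.
have {}Pp i : P i s <-> exists n, p n (i :: s) by exact: (Pp (i :: s)).
split=> [H|[n /allP H] i ib]; last first.
  by apply/Pp; exists n; apply: H; rewrite mem_iota.
elim: (b s) H => [|k IH] H; first by exists 0.
have [m /allP pm] := IH (fun i ik => H i (ltnW ik)).
have [n pn] := (Pp k).1 (H k (ltnSn k)).
(* By monotonicity the maximum serves the first [k] searches and the last one together. *)
exists (maxn m n); apply/allP => i.
rewrite mem_iota /= add0n ltnS leq_eqVlt => /orP[/eqP->|ik].
  exact: mp (leq_maxr _ _) pn.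
by apply: mp (leq_maxl _ _) _; apply: pm; rewrite mem_iota.
Qed.

(** Dovetailing: one bound limits both the witness and the search that confirms it. *)
Lemma re_ex (P : nat -> seq nat -> Prop) :
  re_pred (fun s => P (var 0 s) (behead s)) -> re_pred (fun s => exists i, P i s).
Proof.
move=> [p [rp mp Pp]].
exists (fun n s => has (fun i => p n (i :: s)) (iota 0 n)).
split=> [|m n s mn /hasP[i im pm]|s].
- have rp' := rpred_swap rp.
  apply: (rpred_has (p := fun i s => p (var 0 s) (i :: behead s))); rfun.
- apply/hasP; exists i; last exact: mp pm.
  by move: im; rewrite !mem_iota => /leq_trans; apply.
have {}Pp i : P i s <-> exists n, p n (i :: s) by exact: (Pp (i :: s)).
split=> [[i /Pp[n pn]]|[n /hasP[i _ pn]]]; last by exists i; apply/Pp; exists n.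
exists (maxn n i.+1); apply/hasP; exists i; last exact: mp (leq_maxl _ _) pn.
by rewrite mem_iota /= add0n leq_maxr.
Qed.

(** * Codes of finite sets *)

Lemma in_fincode i n : (i \in fincode n) = odd (n %/ 2 ^ i).
Proof.
rewrite !inE mem_iota /=; case: ltnP => //= ni.
by rewrite divn_small // (leq_ltn_trans ni) // ltn_expl.
Qed.

Lemma fincode_lt i n : i \in fincode n -> i < n.
Proof. by rewrite !inE mem_iota => /andP[]. Qed.

Lemma fincode_surj (A : {fset nat}) : exists n, fincode n = A.
Proof.
(* A number with [k] prescribed low digits: the lowest is [p 0], the others come from [p \o succn]
   and are shifted by doubling. *)
have bits k : forall p : nat -> bool,
    exists n, forall i, odd (n %/ 2 ^ i) = (i < k) && p i.
  elim: k => [p|k IH p]; first by exists 0 => i; rewrite div0n.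
  have [n np] := IH (p \o succn); exists (p 0 + n.*2) => -[|i].
    by rewrite divn1 oddD odd_double addbF oddb.
  by rewrite expnS divnMA divn2 half_bit_double np.
have [n nA] := bits (\max_(x <- A) x).+1 (fun i => i \in A).
exists n; apply/fsetP => i; rewrite in_fincode nA.
rewrite andbC; case: (boolP (i \in A)) => //= iA.
by rewrite ltnS (leq_bigmax_seq (F := id)).
Qed.

(** Membership of a point thus becomes a comparison with a coded compact element, the form in which
    values of a function are assumed decidable. *)
Lemma fincode_exp2 n : fincode (2 ^ n) = [fset n]%fset.
Proof.
apply/fsetP => i; rewrite in_fincode inE; have [ni|ine] := leqP i n.
  by rewrite -expnB // oddX orbF subn_eq0 eqn_leq ni.
by rewrite divn_small ?ltn_exp2l // gtn_eqF.
Qed.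

Lemma rpred_fincode a b : rfun a -> rfun b -> rpred (fun s => a s \in fincode (b s)).
Proof.
move=> ra rb.
by rewrite (_ : (fun _ => _) = fun s => odd (b s %/ 2 ^ a s));
  [rfun|apply/funext => s; rewrite in_fincode].
Qed.
#[local] Hint Resolve rpred_fincode : rfun.

Lemma rpred_fincode_sub a b : rfun a -> rfun b ->
  rpred (fun s => (fincode (a s) `<=` fincode (b s))%fset).
Proof.
move=> ra rb; rewrite (_ : (fun _ => _) = fun s =>
  all (fun i => (i \in fincode (a s)) ==> (i \in fincode (b s))) (iota 0 (a s))).
  apply: (rpred_all (p := fun i s => (i \in fincode (a s)) ==> (i \in fincode (b s))));
    rfun.
apply/funext => s; apply/fsubsetP/allP => [ab i _|ab i ia].
  by apply/implyP; exact: ab.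
by apply: (implyP (ab i _)) => //; rewrite mem_iota fincode_lt.
Qed.
#[local] Hint Resolve rpred_fincode_sub : rfun.

(** This is what bounds the quantifiers over the pairs in a code. With [s := i + j], the first bound
    reduces to [s * 2 <= s * s.+1]. *)
Lemma cpair_ge i j : i <= cpair i j /\ j <= cpair i j.
Proof.
split; last exact: leq_addl.
apply: leq_trans (leq_addr _ _); apply: (leq_trans (leq_addr j i)).
rewrite -[X in X <= _]doubleK half_leq // -muln2.
case: (i + j) => // n; exact: leq_mul.
Qed.

Lemma cpair_lt i j n : cpair i j \in fincode n -> i < n /\ j < n.
Proof.
move=> /fincode_lt ijn; have [ic jc] := cpair_ge i j.
by split; [exact: leq_ltn_trans ijn|exact: leq_ltn_trans ijn].
Qed.

(** * Function spaces over complete codomains *)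

(** Stronger than bounded completeness: it holds of powersets and passes to function spaces, where
    every family of steps then has a join. *)
Definition complete d (E : porderType d) : Prop :=
  forall A : set E, exists s, isLub A s.

Lemma isLub_uniq d (E : porderType d) (A : set E) x y :
  isLub A x -> isLub A y -> x = y.
Proof.
by move=> [ux lx] [uy ly]; apply: le_anti; rewrite lx // ly.
Qed.

Lemma isLub_bigcup T (A : set (set T)) : isLub A (\bigcup_(Y in A) Y).
Proof.
split=> [Y AY|Z ubZ]; apply/asboolP; first exact: bigcup_sup.
by apply: bigcup_sub => Y /ubZ /asboolP.
Qed.

Lemma complete_set T : complete (set T).
Proof. by move=> A; eexists; exact: isLub_bigcup. Qed.

Lemma contfun_homo d (D : porderType d) d' (E : porderType d')
    (f : contfun D E) x y : (x <= y)%O -> (f x <= f y)%O.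
Proof.
move=> xy.
have dA : directed [set x; y].
  by split=> [|_ _ [->|->] [->|->]]; exists y => //=; by [right|left].
have lA : isLub [set x; y] y.
  by split=> [_ [->|->]|z ubz] //; apply: ubz; right.
by have [ub _] := contfunP f dA lA; apply: ub; exists x => //; left.
Qed.

(** Suprema over [S] and over directed sets commute, so a pointwise join of continuous functions is
    continuous. *)
Lemma pointwise_lub d (D : porderType d) d' (E : porderType d')
    (S : set (contfun D E)) (s : D -> E) :
  (forall x, isLub [set g x | g in S] (s x)) ->
  exists2 f : contfun D E, forall x, f x = s x & isLub S f.
Proof.
move=> lS; have cs : scott_continuous s.
  move=> A a dA la; split=> [_ [y Ay <-]|z ubz].
    apply: (lS y).2 => _ [g Sg <-].
    have [ub _] := contfunP g dA la.
    by apply: le_trans (ub _ _) ((lS a).1 _ _); [exists y|exists g].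
  apply: (lS a).2 => _ [g Sg <-]; apply: (contfunP g dA la).2 => _ [y Ay <-].
  by apply: le_trans ((lS y).1 _ _) (ubz _ _); [exists g|exists y].
exists (ContFun cs) => //; split=> [g Sg|h ubh]; apply/contfun_leP => x /=.
  by apply: (lS x).1; exists g.
by apply: (lS x).2 => _ [g Sg <-]; have /contfun_leP := ubh _ Sg; apply.
Qed.

(** Completeness provides a pointwise join, and uniqueness of least upper bounds identifies it with
    [f]. *)
Lemma isLub_contfun d (D : porderType d) d' (E : porderType d')
    (S : set (contfun D E)) f :
  complete E -> isLub S f -> forall x, isLub [set g x | g in S] (f x).
Proof.
move=> cE lf; have [s lS] := choice (fun x => cE [set g x | g in S]).
have [h hs lh] := pointwise_lub lS.
by move=> x; rewrite (isLub_uniq lf lh) hs.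
Qed.

Lemma complete_contfun d (D : porderType d) d' (E : porderType d') :
  complete E -> complete (contfun D E).
Proof.
move=> cE S; have [s lS] := choice (fun x => cE [set g x | g in S]).
by have [h _ lh] := pointwise_lub lS; exists h.
Qed.

(** Testing at [a] suffices: above [a] the function [g] is monotone, elsewhere the step is
    bottom. *)
Lemma is_step_le d (D : bPOrderType d) d' (E : bPOrderType d')
    (a : D) (b : E) (f g : contfun D E) :
  is_step a b f -> (f <= g)%O <-> (b <= g a)%O.
Proof.
move=> fab; split=> [/contfun_leP/(_ a)|ba]; first by rewrite fab lexx.
apply/contfun_leP => x; rewrite fab; case: ifPn => // ax.
exact: le_trans ba (contfun_homo _ ax).
Qed.

(** Compactness of [a] gives continuity: if [a] is below a directed supremum, it is below a member,
    where the value [b] is already reached. *)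
Lemma ex_step d (D : bPOrderType d) d' (E : bPOrderType d') (a : D) (b : E) :
  compact_elt a -> exists f : contfun D E, is_step a b f.
Proof.
move=> ca; pose f x := if (a <= x)%O then b else \bot%O.
suff cf : scott_continuous f by exists (ContFun cf).
move=> A s dA ls; split=> [_ [y Ay <-]|z ubz]; rewrite /f.
  case: ifPn => // ay; first by rewrite (le_trans ay) // ls.1.
case: ifPn => // /(ca _ _ dA ls)[y Ay ay].
by have := ubz (f y); rewrite /f ay; apply; exists y; rewrite // ay.
Qed.

(** Merges finitely many upward closed conditions, each met somewhere in a directed set, into one
    member. *)
Lemma directed_all d (D : porderType d) (A : set D) (T : eqType)
    (P : T -> D -> Prop) (l : seq T) :
  directed A -> (forall t x y, (x <= y)%O -> P t x -> P t y) ->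
  (forall t, exists2 a, A a & P t a) ->
  exists2 a, A a & {in l, forall t, P t a}.
Proof.
move=> [[a Aa] dA] Pm AP; elim: l => [|t l [x Ax lx]]; first by exists a.
have [y Ay ty] := AP t; have [z Az [xz yz]] := dA _ _ Ax Ay.
exists z => // u; rewrite inE => /orP[/eqP ->|/lx]; first exact: Pm ty.
exact: Pm.
Qed.

Section NumFun.
Context d (D : bPOrderType d) (numD : nat -> D).
Context d' (E : bPOrderType d') (numE : nat -> E).
Hypothesis cE : complete E.
Hypothesis numDc : forall i, compact_elt (numD i).

Lemma num_fun_lub n : isLub [set f | exists i j,
  cpair i j \in fincode n /\ is_step (numD i) (numE j) f] (num_fun numD numE n).
Proof.
rewrite /num_fun; set S := [set f | _]; have [s ls] := complete_contfun cE S.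
(* The default bottom is the join of the empty family; for other families completeness provides a
   genuine join. *)
rewrite /supremum; case: eqP => [->|_]; first by split=> // f _; exact: le0x.
by case: xgetP => [x _ //|/(_ s)[]]; exact: ls.
Qed.

(** Compactness of [numD i] ensures that the step named by a coded pair exists, so each pair
    contributes its condition. *)
Lemma num_fun_le n g : (num_fun numD numE n <= g)%O <->
  forall i j, cpair i j \in fincode n -> (numE j <= g (numD i))%O.
Proof.
have [ub lub] := num_fun_lub n; split=> [ng i j ijn|H].
  have [f fij] := ex_step (numE j) (@numDc i).
  by apply/(is_step_le _ fij)/(le_trans _ ng)/ub; exists i, j.
by apply: lub => f [i [j [ijn fij]]]; apply/(is_step_le _ fij)/H.
Qed.

(** Being above [num_fun numD numE n] is a finite set of pointwise conditions. Each is reached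
    inside [A] by compactness of [numE j], and directedness merges them. *)
Lemma num_fun_compact n : (forall j, compact_elt (numE j)) ->
  compact_elt (num_fun numD numE n).
Proof.
move=> numEc A s dA ls /num_fun_le ns.
(* The condition is vacuous off the code, because [directed_all] wants a member of [A] for every
   pair. *)
pose P (ij : nat * nat) (h : contfun D E) :=
  cpair ij.1 ij.2 \in fincode n -> (numE ij.2 <= h (numD ij.1))%O.
have [|[i j]|h Ah Ph] := directed_all
  (P := P) [seq (i, j) | i <- iota 0 n, j <- iota 0 n] dA.
- by move=> ij f g /contfun_leP fg Pf /Pf /le_trans; apply.
- have [ijn|ijn] := boolP (cpair i j \in fincode n); last first.
    by have [[h Ah] _] := dA; exists h => //; rewrite /P (negbTE ijn).
  have dAi : directed [set h (numD i) | h in A].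
    have [[h Ah] dA'] := dA; split; first by exists (h (numD i)), h.
    move=> _ _ [f Af <-] [g Ag <-].
    have [k Ak [/contfun_leP fk /contfun_leP gk]] :=
      dA' _ _ Af Ag.
    by exists (k (numD i)); [exists k|].
  have lsi := isLub_contfun cE ls (numD i).
  have [_ [h Ah <-] jh] := @numEc j _ _ dAi lsi (ns _ _ ijn).
  by exists h.
exists h => //; apply/num_fun_le => i j ijn; apply: (Ph (i, j)) => //.
have [ni nj] := cpair_lt ijn.
by apply: allpairs_f; rewrite mem_iota.
Qed.

End NumFun.

(** * Graph models *)

Section SetNum.
Context (G : choiceType) (enc : G -> nat) (dec : nat -> G).
Hypothesis encK : cancel enc dec.
Hypothesis decK : cancel dec enc.
Local Notation num := (set_num dec).

Lemma in_fin_num n g : (g \in fin_num dec n) = (enc g \in fincode n).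
Proof.
apply/imfsetP/idP => /= [[i ni ->]|gn]; first by rewrite decK.
by exists (enc g); rewrite ?encK.
Qed.

Lemma set_numE n g : num n g <-> enc g \in fincode n.
Proof. by rewrite /set_num /= in_fin_num. Qed.

Lemma fin_num_surj (a : {fset G}) : exists n, fin_num dec n = a.
Proof.
have [n na] := fincode_surj [fset enc g | g in a]%fset.
exists n; apply/fsetP => g; rewrite in_fin_num na.
by rewrite (mem_imfset _ _ (can_inj encK)).
Qed.

Lemma set_num_le n (X : set G) :
  (num n <= X)%O <-> forall i, i \in fincode n -> X (dec i).
Proof.
split=> [/asboolP nX i ni|H]; first by apply/nX/set_numE; rewrite decK.
by apply/asboolP => g /set_numE /H; rewrite encK.
Qed.

Lemma set_num_sub m n :
  (fincode m `<=` fincode n)%fset <-> num m `<=` num n.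
Proof.
split=> [/fsubsetP mn g /set_numE/mn/set_numE //|mn].
apply/fsubsetP => i im; have /mn/set_numE : num m (dec i).
  by apply/set_numE; rewrite decK.
by rewrite decK.
Qed.

Lemma set_num_compact n : compact_elt (num n).
Proof.
move=> A X dA lX /asboolP nX.
by have [Y AY nY] := directed_fsub dA lX nX; exists Y => //; apply/asboolP.
Qed.

(** Algebraicity, phrased with the range of [num] because the description of the compact elements is
    derived from it. *)
Lemma directed_set_num (X : set G) :
  let K := [set Y | range num Y /\ (Y <= X)%O] in directed K /\ isLub K X.
Proof.
move=> K; split; [split|split].
- exists (num 0); split; first by exists 0.
  by apply/set_num_le => i /fincode_lt.
- move=> _ _ [[m _ <-] mX] [[n _ <-] nX].
  have [k kmn] := fincode_surj (fincode m `|` fincode n)%fset.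
  exists (num k).
    split; first by exists k.
    move/set_num_le in mX; move/set_num_le in nX.
    by apply/set_num_le => i; rewrite kmn inE => /orP[/mX|/nX].
  by split; apply/asboolP/set_num_sub; rewrite kmn ?fsubsetUl ?fsubsetUr.
- by move=> Y [].
- move=> Z ubZ; apply/asboolP => g Xg.
  have [n ng] := fin_num_surj [fset g]%fset.
  have /asboolP nZ : (num n <= Z)%O.
    apply: ubZ; split; first by exists n.
    by apply/asboolP => h; rewrite /set_num /= ng inE => /eqP ->.
  by apply: nZ; rewrite /set_num /= ng inE.
Qed.

(** A compact set is the directed join of the coded sets below it, hence lies below one of them and
    equals it. *)
Lemma compact_set (X : set G) : compact_elt X <-> range num X.
Proof.
split=> [cX|[n _ <-]]; last exact: set_num_compact.
have [dK lK] := directed_set_num X.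
have [Y [rY YX] XY] := cX _ _ dK lK (lexx X).
by rewrite (_ : X = Y) //; apply: le_anti; rewrite XY YX.
Qed.

Lemma compact_finite_set (X : set G) : compact_elt X <-> finite_set X.
Proof.
rewrite compact_set finite_fsetP; split=> [[n _ <-]|[a ->]].
  by exists (fin_num dec n).
by have [n <-] := fin_num_surj a; exists n.
Qed.

Lemma scott_domain_set : scott_domain (set G).
Proof.
split=> [A _|X|A _]; do ?exact: complete_set.
rewrite (_ : [set Y | _] = [set Y | range num Y /\ (Y <= X)%O]).
  exact: directed_set_num.
by apply/seteqP; split=> Y /=; rewrite compact_set.
Qed.

Lemma isLub_set_num m n k : isLub [set num m; num k] (num n) <->
  fincode n = (fincode m `|` fincode k)%fset.
Proof.
split=> [ln|nmk].
  apply/fsetP => i; rewrite inE; apply/idP/orP => [|[im|ik]].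
  - rewrite -{1}(decK i) => /set_numE /(isLub_set ln).
    by move=> [_ [->|->]] /set_numE; rewrite decK; [left|right].
  - rewrite -(decK i); apply/set_numE/(isLub_set ln); exists (num m); first by left.
    by apply/set_numE; rewrite decK.
  - rewrite -(decK i); apply/set_numE/(isLub_set ln); exists (num k); first by right.
    by apply/set_numE; rewrite decK.
split=> [_ [->|->]|Z ubZ].
- by apply/asboolP/set_num_sub; rewrite nmk fsubsetUl.
- by apply/asboolP/set_num_sub; rewrite nmk fsubsetUr.
have /set_num_le mZ : (num m <= Z)%O by apply: ubZ; left.
have /set_num_le kZ : (num k <= Z)%O by apply: ubZ; right.
by apply/set_num_le => i; rewrite nmk inE => /orP[/mZ|/kZ].
Qed.

Lemma effective_domain_set : effective_domain num.
Proof.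
split; first exact: scott_domain_set.
- by apply/seteqP; split=> X /=; rewrite compact_set.
- apply: (decidable_rpred (p := fun=> true)) => [|v]; first exact: rfun_cst.
  by split=> // _; exists setT => X _; apply/asboolP.
(* [var 0 s] codes the candidate join; its elements are smaller than the code, which bounds the last
   inclusion. *)
pose p (s : seq nat) :=
  [&& (fincode (var 1 s) `<=` fincode (var 0 s))%fset,
      (fincode (var 2 s) `<=` fincode (var 0 s))%fset &
      all (fun i => (i \in fincode (var 0 s)) ==>
        (i \in fincode (var 1 s)) || (i \in fincode (var 2 s)))
        (iota 0 (var 0 s))].
have rp : rpred p.
  apply: rpred_and; [rfun|apply: rpred_and; first rfun].
  by apply: (rpred_all (p := fun i s => (i \in fincode (var 0 s)) ==>
        (i \in fincode (var 1 s)) || (i \in fincode (var 2 s)))); rfun.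
apply: (decidable_rpred rp) => v.
rewrite isLub_set_num -/(var 0 _) -/(var 1 _) -/(var 2 _).
rewrite /p; split=> [->|/and3P[mn kn /allP nmk]].
  rewrite fsubsetUl fsubsetUr /=; apply/allP => i _; apply/implyP.
  by rewrite inE.
apply/eqP; rewrite eqEfsubset fsubUset mn kn !andbT; apply/fsubsetP => i im.
by rewrite inE; apply: (implyP (nmk i _)) => //; rewrite mem_iota fincode_lt.
Qed.

End SetNum.

(** * Effectiveness of application and abstraction *)

Section GraphRec.
Context (G : choiceType) (M : graph_model G) (enc : G -> nat) (dec : nat -> G).
Hypothesis encK : cancel enc dec.
Hypothesis decK : cancel dec enc.
Hypothesis c_computable :
  computable2 (fun n i => enc (M (fin_num dec n, dec i))).
Local Notation num := (set_num dec).
Local Notation code n i := (enc (M (fin_num dec n, dec i))).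

Lemma rfun_code a b : rfun a -> rfun b -> rfun (fun s => code (a s) (b s)).
Proof. exact: rfun_comp2 c_computable. Qed.
#[local] Hint Resolve rfun_code : rfun.

Let numc n : compact_elt (num n) := @set_num_compact _ dec n.

Lemma fun_num_le n (g : [cont set G -> set G]) :
  (num_fun num num n <= g)%O <->
  forall i j, cpair i j \in fincode n -> (num j <= g (num i))%O.
Proof. exact: num_fun_le (@complete_set G) numc n g. Qed.

(** Joins of functions are pointwise and joins of sets are unions, so a single step of the code
    contributes the point. *)
Lemma fun_num_app n a x : num_fun num num n (num a) (dec x) <->
  exists i j, [&& cpair i j \in fincode n, (fincode i `<=` fincode a)%fset &
                  x \in fincode j].
Proof.
have lf := num_fun_lub num num (@complete_set G) n.
rewrite (isLub_set (isLub_contfun (@complete_set G) lf (num a))); split.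
  move=> [_ [f [i [j [ijn fij]]] <-]]; rewrite fij; case: ifPn => // /asboolP ia.
  move=> /(set_numE encK decK); rewrite decK => xj; exists i, j.
  by rewrite ijn xj andbT; apply/(set_num_sub encK decK).
move=> [i [j /and3P[ijn /(set_num_sub encK decK) ia xj]]].
have [f fij] := ex_step (num j) (@numc i).
exists (f (num a)); first by exists f => //; exists i, j.
rewrite fij ifT; last exact/asboolP.
by apply/(set_numE encK decK); rewrite decK.
Qed.

Lemma re_graph_app : re_elt (num_fun num (num_fun num num)) (graph_app M).
Proof.
(* The order is unfolded twice: [j] itself codes steps from [i'] to [j']. What remains is that [x]
   lies in the application of the set [i] to the set [i'], where only [a] is searched without
   bound. *)
pose P (s : seq nat) := forall i, i < var 0 s -> forall j, j < var 0 s ->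
  cpair i j \in fincode (var 0 s) ->
  forall i', i' < j -> forall j', j' < j -> cpair i' j' \in fincode j ->
  forall x, x < j' -> x \in fincode j' ->
  exists a, (fincode a `<=` fincode i')%fset && (code a x \in fincode i).
have rP : re_pred P.
  apply: re_ball; first by rfun.
  apply: re_ball; first by rfun.
  apply: re_imply; first by rfun.
  apply: re_ball; first by rfun.
  apply: re_ball; first by rfun.
  apply: re_imply; first by rfun.
  apply: re_ball; first by rfun.
  apply: re_imply; first by rfun.
  by apply: re_ex; apply: re_rpred; rfun.
apply: (re_pred_rel rP) => v; rewrite /P -/(var 0 _).
rewrite (num_fun_le _ (complete_contfun (@complete_set G)) numc).
have graph_appE i i' x : graph_app M (num i) (num i') (dec x) <->
    exists a, (fincode a `<=` fincode i')%fset && (code a x \in fincode i).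
  split=> [[A Ai' /(set_numE encK decK) Ax]|[a /andP[ai' ax]]].
    have [a aA] := fin_num_surj encK decK A; exists a; rewrite aA Ax andbT.
    by apply/(set_num_sub encK decK); rewrite /set_num aA.
  exists (fin_num dec a); first exact/(set_num_sub encK decK).
  exact/(set_numE encK decK).
split=> [H i _ j _ /H/fun_num_le ij i' _ j' _ /ij|H i j ijn].
  by move=> /(set_num_le encK decK) i'j' x _ /i'j'/graph_appE.
have [ni nj] := cpair_lt ijn; apply/fun_num_le => i' j' ij'.
have [ji' jj'] := cpair_lt ij'; apply/(set_num_le encK decK) => x xj'.
apply/graph_appE; apply: (H i ni j nj ijn i' ji' j' jj' ij') => //.
exact: fincode_lt xj'.
Qed.

Lemma graph_lamE f x : graph_lam M f (dec x) <->
  exists a y, f (num a) (dec y) /\ code a y = x.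
Proof.
split=> [[A [g [fg xE]]]|[a [y [fay xE]]]].
  have [a aA] := fin_num_surj encK decK A; exists a, (enc g).
  by rewrite /set_num aA encK -xE decK.
by exists (fin_num dec a), (dec y); rewrite -xE encK.
Qed.

Lemma re_graph_lam : re_elt (num_fun (num_fun num num) num) (graph_lam M).
Proof.
(* Here [i] codes a function: its step from [p] to [q] puts [y] in the value at [a], and [x] is the
   code of this point of the graph. *)
pose P (s : seq nat) := forall i, i < var 0 s -> forall j, j < var 0 s ->
  cpair i j \in fincode (var 0 s) ->
  forall x, x < j -> x \in fincode j ->
  exists a y p q, [&& cpair p q \in fincode i, (fincode p `<=` fincode a)%fset,
    y \in fincode q & code a y == x].
have rP : re_pred P.
  apply: re_ball; first by rfun.
  apply: re_ball; first by rfun.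
  apply: re_imply; first by rfun.
  apply: re_ball; first by rfun.
  apply: re_imply; first by rfun.
  by do 4!apply: re_ex; apply: re_rpred; rfun.
apply: (re_pred_rel rP) => v; rewrite /P -/(var 0 _).
have fc i : compact_elt (num_fun num num i).
  by apply: num_fun_compact => //; exact: complete_set.
rewrite (num_fun_le _ (@complete_set G) fc).
have lamE i x : graph_lam M (num_fun num num i) (dec x) <->
  exists a y p q, [&& cpair p q \in fincode i, (fincode p `<=` fincode a)%fset,
    y \in fincode q & code a y == x].
  rewrite graph_lamE; split.
    move=> [a [y [/fun_num_app[p [q /and3P[pqi pa yq]]] xE]]].
    by exists a, y, p, q; rewrite pqi pa yq xE eqxx.
  move=> [a [y [p [q /and4P[pqi pa yq /eqP xE]]]]]; exists a, y; split=> //.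
  by apply/fun_num_app; exists p, q; rewrite pqi pa yq.
split=> [H i _ j _ /H/(set_num_le encK decK) ij x _ /ij/lamE //|H i j ijn].
have [ni nj] := cpair_lt ijn; apply/(set_num_le encK decK) => x xj.
apply/lamE; apply: (H i ni j nj ijn) => //; exact: fincode_lt xj.
Qed.

(** Injectivity recovers the pair from its code, and monotonicity passes from the finite set to [X].
    Conversely, by continuity a point of [f X] already lies in the value at a finite subset. *)
Lemma graph_lamK f : graph_app M (graph_lam M f) = f.
Proof.
apply: contfun_ext => X; apply/seteqP; split=> al.
  move=> [a aX [b [be [fb /(@gm_inj _ M)[ab albe]]]]].
  by rewrite albe; apply: contfun_mono fb; rewrite -ab.
move=> fX; have [dK lK] := directed_set_num encK decK X.
have [_ [Y [[n _ <-] nX] <-] fn] := (isLub_set (contfunP f dK lK) al).1 fX.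
exists (fin_num dec n); first by move/asboolP: nX.
by exists (fin_num dec n), al.
Qed.

Lemma weakly_effective_graph_model :
  weakly_effective_model num (graph_app M) (graph_lam M).
Proof.
split; [exact: (effective_domain_set encK decK)|exact: re_graph_app|
  exact: re_graph_lam|exact: graph_lamK].
Qed.

(** The result consists of second components of pairs coded in [X], and an injection has finite
    preimages of finite sets. *)
Lemma compact_graph_app (X Y : set G) :
  compact_elt X -> compact_elt (graph_app M X Y).
Proof.
rewrite !(compact_finite_set encK decK) => fX.
apply: (@sub_finite_set _ _ (snd @` (M @^-1` X))).
  by move=> al [a _ Xa]; exists (a, al).
apply: finite_image; apply: finite_preimage => // u v _ _; exact: gm_inj.
Qed.

Lemma compact_decidable (X : set G) : compact_elt X -> decidable_elt num X.
Proof.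
move=> /(compact_set encK decK)[m _ <-].
apply: (decidable_rpred
  (p := fun s => (fincode (var 0 s) `<=` fincode m)%fset)); first by rfun.
by move=> v; rewrite (set_num_sub encK decK); split=> /asboolP.
Qed.

Lemma decidable_graph_lam (f : [cont set G -> set G]) :
  decidable1 (fun i => range M (dec i)) ->
  decidable2 (fun m n => (num m <= f (num n))%O) ->
  decidable_elt num (graph_lam M f).
Proof.
move=> /decidable1_rpred[r rE rr] /decidable2_rpred[q qE rq].
(* [coded] looks for a preimage of [x] below [N]; [good] also asks that its second component lie in
   the value of [f] at the first, through the singleton code [2 ^ y]. *)
pose coded x N :=
  has (fun a => has (fun y => code a y == x) (iota 0 N)) (iota 0 N).
pose good x N := has (fun a => has (fun y =>
  (code a y == x) && q (2 ^ y) a) (iota 0 N)) (iota 0 N).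
have rcoded a b : rfun a -> rfun b -> rpred (fun s => coded (a s) (b s)).
  by move=> ra rb; rewrite /coded; rfun.
have rgood a b : rfun a -> rfun b -> rpred (fun s => good (a s) (b s)).
  by move=> ra rb; rewrite /good; rfun.
have fE a y : f (num a) (dec y) <-> q (2 ^ y) a.
  rewrite -qE (set_num_le encK decK) fincode_exp2.
  by split=> [fy i /fset1P -> //|]; apply; rewrite inE.
(* Deciding the range first makes the search total: outside the range any bound is accepted. *)
have [h rh hP] : exists2 h, rfun h &
    forall s, ~~ r (var 0 s) || coded (var 0 s) (h s).
  apply: (rpred_search (p := fun N s => ~~ r (var 0 s) || coded (var 0 s) N)).
    by rfun.
  move=> s; have [/rE[[A g] _ xE]|] := boolP (r (var 0 s)); last by exists 0.
  have [a aA] := fin_num_surj encK decK A.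
  exists (maxn a (enc g)).+1; apply/hasP; exists a.
    by rewrite mem_iota /= add0n ltnS leq_maxl.
  apply/hasP; exists (enc g); first by rewrite mem_iota /= add0n ltnS leq_maxr.
  by rewrite aA encK xE decK.
pose p (s : seq nat) := r (var 0 s) && good (var 0 s) (h s).
have lamE s : graph_lam M f (dec (var 0 s)) <-> p s.
  rewrite /p graph_lamE; move: (var 0 s) (hP s) => x hx.
  split=> [[a [y [fay xE]]]|]; last first.
    move=> /andP[_ /hasP[a _ /hasP[y _ /andP[/eqP xE qya]]]].
    by exists a, y; split=> //; apply/fE.
  have rx : r x by apply/rE; exists (fin_num dec a, dec y); rewrite // -xE encK.
  rewrite rx; move: hx; rewrite rx /= => /hasP[a' a'h /hasP[y' y'h /eqP xE']].
  (* The preimage found below the bound is the only one, so it is the pair that witnesses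
     membership. *)
  have /(can_inj encK)/(@gm_inj _ M)[aa' /(can_inj decK) yy'] : code a' y' = code a y.
    by rewrite xE xE'.
  apply/hasP; exists a' => //; apply/hasP; exists y' => //.
  by rewrite xE' eqxx; apply/fE; rewrite /set_num aa' yy'.
have rp : rpred p by rewrite /p; rfun.
(* The rebuilt list differs from [s] when [s] is empty, so it is handled as a substitution. *)
have rp' : rpred (fun s => p (var 0 s :: behead s)).
  exact: (rfun_subst 1 rp (Forall_cons _ (rfun_var 0) (Forall_nil _))).
apply: (decidable_rpred (p := fun s => all
  (fun i => (i \in fincode (var 0 s)) ==> p (i :: s)) (iota 0 (var 0 s)))).
  apply: (rpred_all (p := fun i s => (i \in fincode (var 0 s)) ==> p (i :: s)));
    rfun.
move=> v; rewrite (set_num_le encK decK) -/(var 0 v).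
split=> [H|/allP H i im].
  by apply/allP => i _; apply/implyP => /H /(lamE (i :: v)).
apply/(lamE (i :: v)); apply: (implyP (H i _)) => //.
by rewrite mem_iota fincode_lt.
Qed.

End GraphRec.

Theorem theorem5 (G : choiceType) (M : graph_model G)
    (enc : G -> nat) (dec : nat -> G) (encK : cancel enc dec)
    (decK : cancel dec enc)
    (c_computable :
      computable2 (fun n i => enc (M (fin_num dec n, dec i)))) :
  weakly_effective_model (set_num dec) (graph_app M) (graph_lam M) /\
  (decidable1 (fun i => range M (dec i)) ->
   effective_model (set_num dec) (graph_app M) (graph_lam M)).
Proof.
split=> [|rM]; first exact: weakly_effective_graph_model.
split; first exact: weakly_effective_graph_model.
- move=> X es cX _; apply: (compact_decidable encK decK).
  (* Each partial application stays compact, and compact elements are decidable. *)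
  elim: es X cX => //= e es IH X cX; apply: IH; exact: (compact_graph_app encK decK).
- by move=> f _; exact: decidable_graph_lam.
Qed.
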